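(* Let $a<0<b$ and let $f,g:[a,b]\to[0,\infty)$ be concave functions with $f(a)=f(b)=g(a)=g(b)=0$, $\max_{[a,b]}f=f(0)$ and $\max_{[a,b]}g=g(0)$. Let $C=\{(x,y)\in[a,b]\times\mathbb{R}:-g(x)\le y\le f(x)\}$. Then $$P_{\gamma_2}(C)=\frac{1}{2\pi}\int_{\partial C}\exp\left(-\frac{x^2+y^2}{2}\right)d\mathcal{H}^1\le\frac{2}{\sqrt{\pi}}.$$
   Context: For a convex set $\Omega\subset\mathbb{R}^2$, its Gaussian perimeter is $P_{\gamma_2}(\Omega)=\frac{1}{2\pi}\int_{\partial\Omega}\exp\left(-\frac{|\mathbf{x}|^2}{2}\right)d\mathcal{H}^1(\mathbf{x})$, where $\mathcal{H}^1$ is the one-dimensional Hausdorff measure. (The paper writes the condition on $g$ as ''$\min_{[a,b]} g = g(0)$'', which would force $g\equiv 0$; the intended condition, used in the proof, is that $g$ attains its maximum at $0$.) *)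

(* Defs.v *)
From HB Require Import structures.
From mathcomp Require Import all_boot all_order all_algebra.
From mathcomp Require Import all_classical all_reals all_analysis.
Set Implicit Arguments. Unset Strict Implicit. Unset Printing Implicit Defensive.
Import Order.TTheory GRing.Theory Num.Theory.
Import numFieldNormedType.Exports.
Local Open Scope classical_set_scope.
Local Open Scope ring_scope.

(* Points of the plane are pairs (x, y) : R * R (product topology = Euclidean). *)

Definition edist2 {R : realType} (p q : R * R) : R :=
  Num.sqrt ((p.1 - q.1) ^+ 2 + (p.2 - q.2) ^+ 2).

(* Diameter of a subset of R^2 (0 for the empty set, possibly +oo). *)
Definition diam2 {R : realType} (E : set (R * R)) : \bar R :=
  ereal_sup ([set 0%E] `|` [set (edist2 p q)%:E | p in E & q in E]).

(* delta-approximation of the 1-dimensional Hausdorff outer measure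
   (normalisation omega_1 / 2 = 1: sums of diameters of countable covers). *)
Definition hausdorff1_delta {R : realType} (delta : R) (A : set (R * R)) : \bar R :=
  ereal_inf [set (\sum_(0 <= n <oo) diam2 (E n))%E
            | E in [set E : nat -> set (R * R) |
                     A `<=` \bigcup_n E n /\ forall n, (diam2 (E n) <= delta%:E)%E]].

Definition hausdorff1 {R : realType} (A : set (R * R)) : \bar R :=
  ereal_sup [set hausdorff1_delta delta A | delta in [set d : R | 0 < d]].

Definition boundary2 {R : realType} (A : set (R * R)) : set (R * R) :=
  closure A `\` interior A.

(* Integral of a nonnegative function phi over a set S with respect to H^1,
   defined by the layer-cake (Cavalieri) formula
     \int_S phi dH^1 = \int_0^oo H^1(S /\ {phi > t}) dt. *)
Definition hausdorff1_integral {R : realType} (S : set (R * R))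
    (phi : R * R -> R) : \bar R :=
  (\int[lebesgue_measure]_(t in [set t : R | (0 <= t)%R])
      hausdorff1 (S `&` [set p | (t < phi p)%R]))%E.

Definition gauss_perimeter2 {R : realType} (A : set (R * R)) : \bar R :=
  (((2 * pi)^-1)%:E *
   hausdorff1_integral (boundary2 A)
     (fun p => expR (- (p.1 ^+ 2 + p.2 ^+ 2) / 2)))%E.

Definition concave_on {R : realType} (a b : R) (f : R -> R) : Prop :=
  forall x y t : R, a <= x <= b -> a <= y <= b -> 0 <= t <= 1 ->
    (1 - t) * f x + t * f y <= f ((1 - t) * x + t * y).

(* Main.v *)
(** The four quarters of the boundary are graphs, completed by vertical segments,
    of nonincreasing concave functions.  Each quarter is split at a point (x0, y0)
    maximising x + y: by concavity the slope is at most 1 in absolute value on the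
    part to the left and above that point, and at least 1 on the part to the right
    and below.  On the left part dH^1 <= sqrt 2 dx and y >= y0; on the right part
    dH^1 <= sqrt 2 dy and x >= x0.  With G(c) the integral of exp(-x^2/2) over [0, c],
    a quarter therefore contributes at most
      sqrt 2 * (G(x0) exp(-y0^2/2) + G(y0) exp(-x0^2/2)).
    Since G(c)^2 <= pi/2 * (1 - exp(-c^2)), writing exp(-x0^2/2) and exp(-y0^2/2) as
    sines of two angles u and v bounds this by sqrt pi * sin (u + v) <= sqrt pi. *)

Require Import Defs.
From HB Require Import structures.
From mathcomp Require Import all_boot all_order all_algebra.
From mathcomp Require Import all_classical all_reals all_analysis.
From mathcomp Require Import measurable_realfun ring lra.
Set Implicit Arguments.
Unset Strict Implicit.
Unset Printing Implicit Defensive.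
Import Order.TTheory GRing.Theory Num.Theory.
Import numFieldNormedType.Exports.
Import gauss_integral_proof.
Local Open Scope classical_set_scope.
Local Open Scope ring_scope.

(** * Sets with fine finite covers *)

(* Finite covers suffice for these sets, and make subadditivity free of series. *)
Definition finely_coverable {R : realType} (A : set (R * R)) (L : R) : Prop :=
  forall delta : R, 0 < delta ->
  exists N (E : nat -> set (R * R)) (d : nat -> R),
    [/\ A `<=` \bigcup_(i < N) E i,
        forall i, (diam2 (E i) <= (d i)%:E)%E,
        forall i, d i <= delta
      & \sum_(i < N) d i <= L].

Lemma diam2_ge0 {R : realType} (E : set (R * R)) : (0 <= diam2 E)%E.
Proof. by apply: ereal_sup_ubound; left. Qed.

Lemma diam2_le {R : realType} (E : set (R * R)) (d : R) : 0 <= d ->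
  (forall p q, E p -> E q -> edist2 p q <= d) -> (diam2 E <= d%:E)%E.
Proof.
move=> d0 Ed; apply: ge_ereal_sup => _ [->|[p Ep [q Eq <-]]]; rewrite lee_fin //.
exact: Ed.
Qed.

Lemma finely_coverableU {R : realType} (A B : set (R * R)) (L M : R) :
  finely_coverable A L -> finely_coverable B M ->
  finely_coverable (A `|` B) (L + M).
Proof.
move=> cA cB delta delta0.
have [N [E [d [AE Ed dle dL]]]] := cA _ delta0.
have [N' [E' [d' [BE Ed' dle' dL']]]] := cB _ delta0.
exists (N + N')%N, (fun i => if (i < N)%N then E i else E' (i - N)%N),
  (fun i => if (i < N)%N then d i else d' (i - N)%N); split.
- move=> p [/AE[i iN Ep]|/BE[i iN Ep]].
  + by exists i; rewrite /= ?iN//= ltn_addr.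
  + exists (N + i)%N => /=; first by rewrite ltn_add2l.
    by rewrite ltnNge leq_addr /= addKn.
- by move=> i; case: ifP.
- by move=> i; case: ifP.
- rewrite big_split_ord/= lerD//.
  + by under eq_bigr do rewrite ltn_ord.
  + by under eq_bigr do rewrite ltnNge leq_addr/= addKn.
Qed.

Lemma finely_coverableS {R : realType} (A B : set (R * R)) (L : R) :
  A `<=` B -> finely_coverable B L -> finely_coverable A L.
Proof.
move=> AB cB delta /cB[N [E [d [BE ? ? ?]]]]; exists N, E, d; split => //.
exact: subset_trans BE.
Qed.

Lemma hausdorff1_finely_coverable {R : realType} (A : set (R * R)) (L : R) :
  finely_coverable A L -> (hausdorff1 A <= L%:E)%E.
Proof.
move=> cA; apply: ge_ereal_sup => _ [delta /= delta0 <-].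
have [N [E [d [AE Ed dle dL]]]] := cA _ delta0.
(* Padding with empty sets turns the finite cover into a sequence; they add nothing, since [diam2]
   of the empty set is 0. *)
pose E' i := if (i < N)%N then E i else set0.
have diam0 : diam2 (@set0 (R * R)) = 0%E.
  by apply/eqP; rewrite eq_le diam2_ge0 andbT; apply: diam2_le.
apply: (@le_trans _ _ (\sum_(0 <= n <oo) diam2 (E' n))%E).
  apply: ereal_inf_lbound; exists E' => //; split.
    by move=> p /AE[i iN Ep]; exists i => //; rewrite /E' ifT.
  move=> n; rewrite /E'; case: ifP => _; last by rewrite diam0 lee_fin ltW.
  by rewrite (le_trans (Ed n))// lee_fin.
rewrite (nneseries_split 0 N); last by move=> *; exact: diam2_ge0.
rewrite add0n [X in (_ + X)%E]eseries0 ?adde0; last first.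
  by move=> i Ni _; rewrite /E' ltnNge Ni.
rewrite big_mkord (le_trans _ (_ : ((\sum_(i < N) d i)%:E <= _)%E)) ?lee_fin//.
rewrite -sumEFin; apply: lee_sum => i _; rewrite /E' ltn_ord; exact: Ed.
Qed.

(** Cutting [A] into [N] slices by the values of [h], each of height [l / N], gives pieces of
    diameter at most [k * l / N]. These bounds add up to [k * l] whatever [N] is, so [N] can be
    taken as large as [delta] requires. *)
Lemma finely_coverable_lipschitz {R : realType} (A : set (R * R))
    (h : R * R -> R) (k l : R) : 0 <= k -> 0 <= l ->
  (forall p, A p -> 0 <= h p <= l) ->
  (forall p q, A p -> A q -> edist2 p q <= k * `|h p - h q|) ->
  finely_coverable A (k * l).
Proof.
move=> k0 l0 hl hk delta delta0.
(* With [k * l / delta < N], the bound [k * w] on a slice is at most [delta]. *)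
pose N := (Num.truncn (k * l / delta)).+1.
have N0 : 0 < N%:R :> R by rewrite ltr0n.
pose w := l / N%:R.
have w0 : 0 <= w by rewrite divr_ge0// ltW.
exists N, (fun i => A `&` [set p | i%:R * w <= h p <= i.+1%:R * w]),
  (fun=> k * w); split.
- move=> p Ap; have /andP[hp0 hpl] := hl _ Ap.
  (* If [l] is 0 then so is [w], and the quotient [h p / w] used below no longer locates the
     slice. *)
  have [lE0|l_gt0] := leP l 0.
    exists 0%N => //=; split=> //=; rewrite mul0r hp0 /= mul1r.
    by apply: le_trans w0; rewrite (le_trans hpl).
  have w_gt0 : 0 < w by rewrite divr_gt0.
  (* The value [l] has quotient [N], one too many; the slices are closed, so it fits into the last
     one, of index [N.-1]. *)
  have [hp_eq|hp_lt] := eqVneq (h p) l.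
    exists N.-1 => //=; split=> //=; rewrite hp_eq /w.
    have -> : N.-1.+1%:R * (l / N%:R) = l by rewrite mulrCA divff ?gt_eqF// mulr1.
    by rewrite lexx andbT mulrCA ger_pMr// ler_pdivrMr// mul1r ler_nat.
  have hpw0 : 0 <= h p / w by rewrite divr_ge0.
  exists (Num.truncn (h p / w)) => /=.
    rewrite -(ltr_nat R); apply: (@le_lt_trans _ _ (h p / w)).
      by rewrite truncn_le.
    rewrite ltr_pdivrMr// /w mulrC divfK ?gt_eqF//.
    by rewrite lt_neqAle hp_lt.
  split => //=; apply/andP; split; first by rewrite -ler_pdivlMr// truncn_le.
  by rewrite -ler_pdivrMr// ltW// truncnS_gt.
- move=> i; apply: diam2_le; first exact: mulr_ge0.
  move=> p q [Ap /andP[p1 p2]] [Aq /andP[q1 q2]].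
  rewrite (le_trans (hk _ _ Ap Aq))// ler_wpM2l// ler_norml.
  move: p2 q2; rewrite -natr1 mulrDl mul1r => p2 q2.
  by apply/andP; split; lra.
- move=> _; rewrite mulrA ler_pdivrMr// [leRHS]mulrC -ler_pdivrMr//.
  by rewrite ltW// truncnS_gt.
- by rewrite sumr_const card_ord -mulr_natr mulrA divfK ?gt_eqF.
Qed.

(** * Descending concave arcs *)

(* The graph of [f] over [[0, b]] together with the vertical segments at its jumps;
   [f] may jump at [b], and then the boundary of the convex set contains such a
   segment. *)
Definition descending_arc {R : realType} (b : R) (f : R -> R) : set (R * R) :=
  [set p | [/\ 0 <= p.1 <= b, 0 <= p.2 <= f 0 &
    forall x, 0 <= x <= b -> (x < p.1 -> p.2 <= f x) /\ (p.1 < x -> f x <= p.2)]].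

(** The value of [f] at the midpoint separates the two ordinates. A third abscissa is used because
    the condition on a point of the arc says nothing at its own abscissa. *)
Lemma descending_arc_anti {R : realType} (b : R) (f : R -> R) (p q : R * R) :
  descending_arc b f p -> descending_arc b f q -> p.1 < q.1 -> q.2 <= p.2.
Proof.
move=> [/andP[p0 pb] _ Hp] [/andP[q0 qb] _ Hq] pq.
pose m := (p.1 + q.1) / 2.
have pm : p.1 < m by rewrite /m; lra.
have mq : m < q.1 by rewrite /m; lra.
have m0b : 0 <= m <= b by apply/andP; split; lra.
by apply: (@le_trans _ _ (f m)); [exact: (Hq _ m0b).1|exact: (Hp _ m0b).2].
Qed.

(* The points [(t * p.1, p.2)] with [t < 1] lie below the graph even when [p] is on a
   vertical segment, whereas [q] lies above the graph just to its right. *)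
Lemma descending_arc_concave {R : realType} (b : R) (f : R -> R)
    (p q r : R * R) : concave_on 0 b f ->
  descending_arc b f p -> descending_arc b f q -> descending_arc b f r ->
  p.1 <= q.1 -> q.1 < r.1 ->
  (r.1 - q.1) * p.2 + (q.1 - p.1) * r.2 <= (r.1 - p.1) * q.2.
Proof.
move=> cf Ap Aq Ar pq qr.
have below s t : descending_arc b f s -> 0 <= t < 1 -> s.2 <= f (t * s.1).
  move=> [/andP[s0 sb] /andP[_ sf0] Hs] /andP[t0 t1].
  have [s_eq0|s_neq0] := eqVneq s.1 0; first by rewrite s_eq0 mulr0.
  have s_gt0 : 0 < s.1 by rewrite lt_neqAle eq_sym s_neq0.
  have ts : t * s.1 < s.1 by rewrite gtr_pMl.
  by apply: (Hs _ _).1 => //; rewrite mulr_ge0//= (le_trans (ltW ts)).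
have [/andP[p0 pb] /andP[p20 _] _] := Ap; have [/andP[r0 rb] /andP[r20 _] _] := Ar.
have [/andP[q0 qb] _ Hq] := Aq.
(* The inequality is first proved with weights taken at some [z] to the right of [q.1], where the
   graph lies below [q.2]; then [z] tends to [q.1]. *)
have key z : q.1 < z -> z < r.1 ->
    (r.1 - z) * p.2 + (z - p.1) * r.2 <= (r.1 - p.1) * q.2.
  move=> qz zr; have z0 : 0 < z by lra.
  (* Scaling by [t] sends [z] to the midpoint of [q.1] and [z], still right of [q.1], while [t < 1]
     keeps the scaled points from [p] and [r] below the graph. *)
  pose t := ((q.1 + z) / 2) / z.
  have tz : t * z = (q.1 + z) / 2 by rewrite divfK// gt_eqF.
  have t0 : 0 <= t by rewrite divr_ge0//; lra.
  have t1 : t < 1 by rewrite ltr_pdivrMr// mul1r; lra.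
  have tb u : 0 <= u <= b -> 0 <= t * u <= b.
    move=> /andP[u0 ub]; rewrite mulr_ge0//= (le_trans _ ub)// ler_piMl// ltW//.
  pose l := (z - p.1) / (r.1 - p.1).
  have rp : 0 < r.1 - p.1 by lra.
  have l01 : 0 <= l <= 1.
    by rewrite divr_ge0 ?ler_pdivrMr ?mul1r//=; lra.
  have := cf (t * p.1) (t * r.1) l (tb _ _) (tb _ _) l01.
  rewrite p0 pb r0 rb => /(_ isT isT).
  have -> : (1 - l) * (t * p.1) + l * (t * r.1) = t * z.
    by rewrite /l; field; rewrite gt_eqF.
  have t01 : 0 <= t < 1 by rewrite t0.
  have fq : f (t * z) <= q.2 by apply: (Hq _ _).2; rewrite tz; lra.
  move=> fz.
  have : (1 - l) * p.2 + l * r.2 <= q.2.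
    case/andP: l01 => l0 l1.
    apply: le_trans fq; apply: le_trans fz; apply: lerD; apply: ler_wpM2l.
    - by rewrite subr_ge0.
    - exact: below.
    - by [].
    - exact: below.
  rewrite -(ler_pM2l rp).
  suff -> : (r.1 - p.1) * ((1 - l) * p.2 + l * r.2) =
    (r.1 - z) * p.2 + (z - p.1) * r.2 by [].
  by rewrite /l; field; rewrite gt_eqF.
(* A failure by [gap] at [q.1] would persist at [q.1 + e]: the shift lowers the left side by at most
   [e * p.2], which is less than [gap]. This contradicts [key]. *)
rewrite leNgt; apply/negP => lt_q.
pose M := (r.1 - p.1) * q.2; rewrite -/M in lt_q key.
pose K := p.2 + r.2 + 1.
pose gap := (r.1 - q.1) * p.2 + (q.1 - p.1) * r.2 - M.
have gap0 : 0 < gap by rewrite /gap subr_gt0.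
have K0 : 0 < K by rewrite /K; lra.
pose e := Num.min ((r.1 - q.1) / 2) (gap / K / 2).
have e0 : 0 < e by rewrite lt_min !divr_gt0 ?subr_gt0.
have e1 : e <= (r.1 - q.1) / 2 by rewrite ge_min lexx.
have e2 : e * K < gap.
  rewrite -ltr_pdivlMr// (@le_lt_trans _ _ (gap / K / 2)) ?ge_min ?lexx ?orbT//.
  by rewrite gtr_pMr ?divr_gt0// invf_lt1// ltr1n.
have := key (q.1 + e); rewrite ltrDl e0 => /(_ isT).
have -> : q.1 + e < r.1 by lra.
move=> /(_ isT); have : gap = (r.1 - q.1) * p.2 + (q.1 - p.1) * r.2 - M by [].
have : 0 <= e * r.2 by rewrite mulr_ge0// ltW.
by move: e2; rewrite /K; lra.
Qed.

(** Along the arc [x + y] is concave, hence nondecreasing up to its maximum [m] and nonincreasing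
    after it. Before [m] this bounds the drop by the horizontal step, so vertical segments are
    excluded there; after [m] it bounds the horizontal step by the drop. *)
Lemma descending_arc_split {R : realType} (b : R) (f : R -> R) (m : R * R) :
  concave_on 0 b f -> descending_arc b f m ->
  (forall p, descending_arc b f p -> p.1 + p.2 <= m.1 + m.2) ->
  [/\ forall p, descending_arc b f p ->
        (p.1 <= m.1 /\ m.2 <= p.2) \/ (m.1 <= p.1 /\ p.2 <= m.2),
      forall p q, descending_arc b f p -> descending_arc b f q ->
        p.1 <= m.1 -> q.1 <= m.1 -> m.2 <= p.2 -> m.2 <= q.2 ->
        `|p.2 - q.2| <= `|p.1 - q.1|
    & forall p q, descending_arc b f p -> descending_arc b f q ->
        m.1 <= p.1 -> m.1 <= q.1 -> p.2 <= m.2 -> q.2 <= m.2 ->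
        `|p.1 - q.1| <= `|p.2 - q.2|].
Proof.
move=> cf Am mmax; split.
- move=> p Ap; case: (ltgtP p.1 m.1) => [pm|mp|pm].
  + by left; split => //; exact: (descending_arc_anti Ap Am pm).
  + by right; split => //; exact: (descending_arc_anti Am Ap mp).
  + by case: (leP m.2 p.2) => [|/ltW]; [left|right].
- have half p q : descending_arc b f p -> descending_arc b f q ->
      p.1 <= q.1 -> q.1 <= m.1 -> m.2 <= p.2 -> m.2 <= q.2 ->
      p.2 - q.2 <= q.1 - p.1.
    move=> Ap Aq pq qm mp mq; have sp := mmax _ Ap; have sq := mmax _ Aq.
    (* Concavity is applied to [p], [q], [m] and needs [q.1 < m.1]. At equality maximality forces
       [q.2 = m.2], and the claim is the maximality of [m] against [p]. *)
    have [qm1|qm1] := eqVneq q.1 m.1; first by lra.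
    have {}qm : q.1 < m.1 by rewrite lt_neqAle qm1.
    have := descending_arc_concave cf Ap Aq Am pq qm => conc.
    have mp0 : 0 < m.1 - p.1 by lra.
    have : (q.1 - p.1) * (p.1 + p.2) <= (q.1 - p.1) * (m.1 + m.2).
      by rewrite ler_wpM2l// subr_ge0.
    move=> smax; rewrite -(ler_pM2l mp0); lra.
  have anti p q : descending_arc b f p -> descending_arc b f q ->
      p.1 <= q.1 -> q.1 <= m.1 -> m.2 <= p.2 -> m.2 <= q.2 ->
      q.2 - p.2 <= q.1 - p.1.
    move=> Ap Aq pq qm mp mq; have [pqE|pq1] := eqVneq p.1 q.1.
      by have := half q p Aq Ap; rewrite pqE lexx => /(_ isT qm mq mp).
    have : q.2 <= p.2 by apply: (descending_arc_anti Ap Aq); rewrite lt_neqAle pq1.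
    lra.
  move=> p q Ap Aq pm qm mp mq.
  have [pq|/ltW qp] := leP p.1 q.1.
  + rewrite (distrC p.1) (ger0_norm (_ : 0 <= q.1 - p.1)) ?subr_ge0//.
    by rewrite ler_norml half// lerNl opprB anti.
  + rewrite (ger0_norm (_ : 0 <= p.1 - q.1)) ?subr_ge0// distrC.
    by rewrite ler_norml half// lerNl opprB anti.
- have half p q : descending_arc b f p -> descending_arc b f q ->
      p.1 < q.1 -> m.1 <= p.1 -> q.1 - p.1 <= p.2 - q.2.
    move=> Ap Aq pq mp; have sq := mmax _ Aq.
    have conc := descending_arc_concave cf Am Ap Aq mp pq.
    have mq0 : 0 < q.1 - m.1 by lra.
    have : (q.1 - p.1) * (q.1 + q.2) <= (q.1 - p.1) * (m.1 + m.2).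
      by rewrite ler_wpM2l// subr_ge0 ltW.
    move=> smax; rewrite -(ler_pM2l mq0); lra.
  move=> p q Ap Aq mp mq pm qm; case: (ltgtP p.1 q.1) => [pq|qp|->].
  + rewrite distrC ger0_norm ?subr_ge0 ?(ltW pq)//.
    exact: (le_trans (half _ _ Ap Aq pq mp) (ler_norm _)).
  + rewrite ger0_norm ?subr_ge0 ?(ltW qp)// distrC.
    exact: (le_trans (half _ _ Aq Ap qp mq) (ler_norm _)).
  + by rewrite subrr normr0.
Qed.

(** * The boundary as a union of arcs *)

Lemma closed_le_fun {R : realType} (h : R * R -> R) (c : R) :
  continuous h -> closed [set p | h p <= c].
Proof.
by move=> hc; apply: (preimage_closed _ (@closed_le R c)) => p _; exact: hc.
Qed.

Lemma closed_ge_fun {R : realType} (h : R * R -> R) (c : R) :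
  continuous h -> closed [set p | c <= h p].
Proof.
by move=> hc; apply: (preimage_closed _ (@closed_ge R c)) => p _; exact: hc.
Qed.

Lemma continuous_fst_plane {R : realType} : continuous (fun p : R * R => p.1).
Proof. by move=> p; exact: cvg_fst. Qed.

Lemma continuous_snd_plane {R : realType} : continuous (fun p : R * R => p.2).
Proof. by move=> p; exact: cvg_snd. Qed.

Lemma continuous_pair {T : topologicalType} {R : realType} (f g : T -> R) :
  continuous f -> continuous g -> continuous (fun q => (f q, g q)).
Proof.
move=> cf cg p.
exact: (@cvg_pair _ _ _ (nbhs p) (nbhs (f p)) (nbhs (g p)) _ _ _ _ _ (cf p) (cg p)).
Qed.

Lemma continuousN_plane {R : realType} (k : R * R -> R) :
  continuous k -> continuous (fun p => - k p).
Proof. by move=> ck p; apply: cvgN; exact: ck. Qed.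

Lemma descending_arc_argmax {R : realType} (b : R) (f : R -> R) : 0 <= b ->
  (forall x, 0 <= x <= b -> 0 <= f x <= f 0) ->
  exists2 m, descending_arc b f m &
    forall p, descending_arc b f p -> p.1 + p.2 <= m.1 + m.2.
Proof.
move=> b0 f0.
have [||| m Am mmax] := @compact_EVT_max (R * R)%type R
    (fun p => p.1 + p.2) (descending_arc b f).
- have /andP[f00 _] : 0 <= f 0 <= f 0 by apply: f0; rewrite lexx.
  exists (0, f 0); split; rewrite /= ?lexx ?b0 ?f00// => x xb; split.
    by case/andP: xb => x0 _; rewrite ltNge x0.
  by move=> _; case/andP: (f0 _ xb).
- apply: (@subclosed_compact _ _ (`[0, b] `*` `[0, f 0])).
  (* For fixed [x] each implication is a union of two closed half planes, so the arc is closed for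
     an arbitrary [f]. *)
  + rewrite (_ : descending_arc b f =
      ([set p | 0 <= p.1] `&` [set p | p.1 <= b]) `&`
      ([set p | 0 <= p.2] `&` [set p | p.2 <= f 0]) `&`
      \bigcap_(x in [set x | 0 <= x <= b])
        (([set p | p.1 <= x] `|` [set p | p.2 <= f x]) `&`
         ([set p | x <= p.1] `|` [set p | f x <= p.2]))).
      have c1 := @continuous_fst_plane R; have c2 := @continuous_snd_plane R.
      apply: closedI; first apply: closedI; try apply: closedI.
      * exact: closed_ge_fun.
      * exact: closed_le_fun.
      * exact: closed_ge_fun.
      * exact: closed_le_fun.
      * apply: closed_bigI => x _; apply: closedI; apply: closedU.
        - exact: closed_le_fun.
        - exact: closed_le_fun.
        - exact: closed_ge_fun.
        - exact: closed_ge_fun.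
    apply/seteqP; split => p /=.
      move=> [/andP[? ?] /andP[? ?] H]; split=> // x /= /H[H1 H2]; split=> /=.
        by have [?|/H1] := leP p.1 x; [left|right].
      by have [?|/H2] := leP x p.1; [left|right].
    move=> [[[p1 p2] [p3 p4]] H]; split; [exact/andP|exact/andP|].
    move=> x xb; have [H1 H2] := H _ xb; split.
      by rewrite ltNge; case: H1 => [/= ->|].
    by rewrite ltNge; case: H2 => [/= ->|].
  + by apply: compact_setX; exact: segment_compact.
  + by move=> p [? ? _]; split; rewrite /= in_itv.
- apply: continuous_subspaceT => p; apply: continuousD.
    exact: continuous_fst_plane.
  exact: continuous_snd_plane.
- by exists m; [exact: set_mem|move=> p Ap; apply: mmax; exact: mem_set].
Qed.

(** Since [u] is the mean of 0 and [v] with weight [u / v] on [v], concavity puts [f u] above the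
    same mean of [f 0] and [f v], of which [f 0] is the larger. *)
Lemma concave_max_nonincreasing {R : realType} (a b : R) (f : R -> R) : a <= 0 ->
  concave_on a b f -> (forall x, a <= x <= b -> f x <= f 0) ->
  forall u v, 0 <= u <= v -> v <= b -> f v <= f u.
Proof.
move=> a0 cf fmax u v /andP[u0 uv] vb.
have [vE0|vN0] := eqVneq v 0.
  by have -> : u = v by apply/eqP; rewrite eq_le uv vE0 u0.
have v0 : 0 < v by rewrite lt_neqAle eq_sym vN0 (le_trans u0).
have va : a <= v <= b by rewrite vb andbT (le_trans a0)// ltW.
have oa : a <= 0 <= b by rewrite a0 (le_trans _ vb)// ltW.
have t01 : 0 <= u / v <= 1 by rewrite divr_ge0 ?(ltW v0)//= ler_pdivrMr// mul1r.
have := cf _ _ _ oa va t01.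
rewrite mulr0 add0r divfK//; apply: le_trans.
have : 0 <= (1 - u / v) * (f 0 - f v).
  by rewrite mulr_ge0 ?subr_ge0 ?fmax//; case/andP: t01.
by move: (u / v) => t; lra.
Qed.

(** Nearby points with nonnegative abscissa stay left of [z], so monotonicity gives [f p.1] at least
    [f z]. When [x] is 0 there are also neighbours with negative abscissa, and for them a chord of
    the graph is used. *)
Lemma near_hypograph {R : realType} (a b : R) (f : R -> R) (x y z : R) :
  a < 0 -> concave_on a b f -> (forall x, a <= x <= b -> f x <= f 0) -> f a = 0 ->
  0 <= f 0 -> 0 <= x -> x < z -> z <= b -> y < f z ->
  \forall p \near (x, y), a <= p.1 <= b /\ p.2 <= f p.1.
Proof.
move=> a0 cf fmax fa f0 x0 xz zb yfz.
have oa : a <= 0 <= b by rewrite ltW//=; lra.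
have aa : a <= a <= b by rewrite lexx/=; lra.
have c1 : p.1 @[p --> (x, y)] --> x by exact: (@continuous_fst_plane R (x, y)).
have c2 : p.2 @[p --> (x, y)] --> y by exact: (@continuous_snd_plane R (x, y)).
(* The chord from [(a, 0)] to [(0, f 0)] bounds [f] from below on [[a, 0]]; its line passes strictly
   above [(x, y)]. *)
have c3 : (1 - p.1 / a) * f 0 - p.2 @[p --> (x, y)] --> (1 - x / a) * f 0 - y.
  apply: cvgB => //; apply: cvgMl; apply: cvgB; first exact: cvg_cst.
  exact: cvgMl.
have fz0 : f z <= f 0 by apply: fmax; rewrite zb andbT; lra.
have pos : 0 < (1 - x / a) * f 0 - y.
  have : 0 <= (- (x / a)) * f 0.
    by rewrite mulr_ge0// -mulrN mulr_ge0// -invrN invr_ge0; lra.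
  lra.
near=> p.
have pz : p.1 < z by near: p; exact: cvgr_lt c1 _ _.
have ap : a < p.1 by near: p; apply: cvgr_gt c1 _ _; lra.
have pf : p.2 < f z by near: p; exact: cvgr_lt c2 _ _.
have pl : 0 < (1 - p.1 / a) * f 0 - p.2 by near: p; exact: cvgr_gt c3 _ _.
split; first by apply/andP; split; lra.
have [p0|p0] := leP 0 p.1.
  apply: (le_trans (ltW pf)).
  apply: (concave_max_nonincreasing (ltW a0) cf fmax) => //.
  by rewrite p0 ltW.
apply: (@le_trans _ _ ((1 - p.1 / a) * f 0)); first by rewrite ltW// -subr_gt0.
have t01 : 0 <= p.1 / a <= 1.
  apply/andP; split; first by rewrite -mulrNN -invrN divr_ge0//; lra.
  by rewrite ler_ndivrMr// mul1r ltW.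
by have := cf _ _ _ oa aa t01; rewrite mulr0 add0r fa mulr0 addr0 divfK// lt_eqF.
Unshelve. all: by end_near. Qed.

(** Being in the closure gives the arc inequalities left of [p.1]; not being interior gives those to
    the right. If [p] were on neither arc, it would lie strictly below [f] and strictly above [- g]
    at abscissas beyond [p.1], hence be interior. *)
Lemma boundary2_right {R : realType} (a b : R) (f g : R -> R) (p : R * R) :
  a < 0 -> concave_on a b f -> concave_on a b g ->
  (forall x, a <= x <= b -> 0 <= f x) ->
  (forall x, a <= x <= b -> 0 <= g x) ->
  f a = 0 -> g a = 0 ->
  (forall x, a <= x <= b -> f x <= f 0) ->
  (forall x, a <= x <= b -> g x <= g 0) ->
  boundary2 [set p : R * R | (a <= p.1 <= b)%R /\ (- g p.1 <= p.2 <= f p.1)%R] p ->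
  0 <= p.1 ->
  descending_arc b f p \/ descending_arc b g (p.1, - p.2).
Proof.
move=> a0 cf cg f_ge0 g_ge0 fa ga fmax gmax [clp intp] p0.
set C := [set _ | _] in clp intp.
have c1 := @continuous_fst_plane R; have c2 := @continuous_snd_plane R.
have closure_in D : closed D -> C `<=` D -> D p.
  by move=> cD CD; rewrite ((closure_id D).1 cD); apply: closureS clp.
have pb : p.1 <= b.
  by apply: (closure_in [set q | q.1 <= b]) => [|q [/andP[]] //]; exact: closed_le_fun.
have ob : a <= 0 <= b by rewrite ltW//= (le_trans p0).
have upper h : (forall x, a <= x <= b -> h x <= h 0) -> concave_on a b h ->
    forall k : R * R -> R, continuous k -> (forall q, C q -> k q <= h q.1) ->
    k p <= h 0 /\ forall x, 0 <= x <= b -> x < p.1 -> k p <= h x.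
  move=> hmax ch k ck Ckh; split.
    apply: (closure_in [set q | k q <= h 0]) => [|q Cq /=]; first exact: closed_le_fun.
    by apply: (le_trans (Ckh _ Cq)); apply: hmax; case: Cq.
  move=> x /andP[x0 xb] xp.
  (* This union is closed and contains [C] because [h] is nonincreasing to the right of 0, so it
     contains [p]; the first half plane is ruled out by [x < p.1]. *)
  have [] // : ([set q | q.1 <= x] `|` [set q | k q <= h x]) p; last first.
    by move=> /=; rewrite leNgt xp.
  apply: closure_in.
    by apply: closedU; exact: closed_le_fun.
  move=> q Cq; have [qx|xq] := leP q.1 x; [by left|right] => /=.
  apply: (le_trans (Ckh _ Cq)).
  apply: (concave_max_nonincreasing (ltW a0) ch hmax); first by rewrite x0 ltW.
  by case: Cq => /andP[].
have [uf0 uf] := upper f fmax cf _ c2 (fun q Cq => (andP Cq.2).2).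
have [ug0 ug] : - p.2 <= g 0 /\ forall x, 0 <= x <= b -> x < p.1 -> - p.2 <= g x.
  apply: (upper g gmax cg (fun q => - q.2)).
    exact: continuousN_plane.
  by move=> q [_ /andP[]]; rewrite lerNl.
have dicho h y : y <= h 0 ->
    (forall x, 0 <= x <= b -> x < p.1 -> y <= h x) ->
    [\/ descending_arc b h (p.1, y), y < 0 |
        exists2 z, p.1 < z <= b & y < h z].
  move=> yh0 hy; have [y0|y0] := ltP y 0; first exact: Or32.
  have [z|nz] := pselect (exists2 z, p.1 < z <= b & y < h z); first exact: Or33.
  apply: Or31; split => //=; rewrite ?p0 ?y0// => x xb; split; first exact: hy.
  move=> px; rewrite leNgt; apply/negP => yx; apply: nz; exists x => //.
  by rewrite px; case/andP: xb.
have bab : a <= b <= b by rewrite lexx andbT; case/andP: ob => /le_trans; apply.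
have interior_p z z' : p.1 < z <= b -> p.1 < z' <= b ->
    p.2 < f z -> - p.2 < g z' -> False.
  move=> /andP[pz zb] /andP[pz' z'b] fz gz'; apply: intp.
  have nf := near_hypograph a0 cf fmax fa (f_ge0 _ ob) p0 pz zb fz.
  have ng := near_hypograph a0 cg gmax ga (g_ge0 _ ob) p0 pz' z'b gz'.
  suff : nbhs (p.1, p.2) C by case: (p).
  have {}ng := continuous_pair c1 (continuousN_plane c2) (x := (p.1, p.2)) ng.
  apply: filterS2 nf ng => q [qab qf] [_ qg].
  by split=> //; rewrite lerNl qg qf.
case: (dicho f p.2 uf0 uf) => [?|y0|[z pz fz]].
- by left; rewrite (surjective_pairing p).
- case: (dicho g (- p.2) ug0 ug) => [?|y0'|[z pz gz]].
  + by right.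
  + by move: y0 y0'; lra.
  (* Here [p.2 < 0], so [b] itself serves as witness for [f], which is nonnegative there. *)
  + case: (interior_p b z) => //.
      by case/andP: pz => pz zb; rewrite lexx andbT (lt_le_trans pz).
    by rewrite (lt_le_trans y0)// f_ge0.
- case: (dicho g (- p.2) ug0 ug) => [?|y0'|[z' pz' gz']].
  + by right.
  + case: (interior_p z b) => //.
      by case/andP: pz => pz zb; rewrite lexx andbT (lt_le_trans pz).
    by rewrite (lt_le_trans y0')// g_ge0.
  + by case: (interior_p z z').
Qed.

Lemma boundary2_involution {R : realType} (h : R * R -> R * R)
    (A : set (R * R)) (p : R * R) :
  continuous h -> involutive h -> boundary2 A p -> boundary2 (h @^-1` A) (h p).
Proof.
move=> ch hh [clp intp]; split.
  move=> B hpB; have [q [Aq Bq]] := clp _ (ch _ _ hpB).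
  by exists (h q); split => //=; rewrite hh.
move=> ihp; apply: intp.
have -> : A = h @^-1` (h @^-1` A) by apply/seteqP; split => q /=; rewrite hh.
exact: (ch _ _ ihp).
Qed.

(** * The Gauss integral over [0, x] *)

Lemma is_derive_gauss_fun {R : realType} (x : R) :
  is_derive x 1 (@gauss_fun R) (- (2 * x) * gauss_fun x).
Proof.
have dq : is_derive x 1 (fun z : R => - z ^+ 2) (- (2 * x)).
  by apply: is_derive_eq; rewrite /GRing.scale/=; ring.
apply: is_derive_eq (is_derive1_comp (is_derive_expR _) dq) _.
by rewrite mulrC.
Qed.

Lemma is_derive_integral0_gauss {R : realType} (x : R) : 0 < x ->
  is_derive x 1 (@integral0_gauss R) (gauss_fun x).
Proof.
move=> x0; have [||||dI IE] := @continuous_FTC1 R gauss_fun (BLeft 0) x (x + 1).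
- by rewrite ltrDl.
- apply: continuous_compact_integrable; first exact: segment_compact.
  by apply: continuous_subspaceT; exact: continuous_gauss_fun.
- by rewrite /= lte_fin.
- exact: continuous_gauss_fun.
by split => //; rewrite -derive1E.
Qed.

Lemma within_continuous_integral0_gauss {R : realType} (x : R) : 0 <= x ->
  {within `[0, x], continuous (@integral0_gauss R)}.
Proof.
move=> x0; apply: parameterized_integral_continuous => //.
apply: continuous_compact_integrable; first exact: segment_compact.
by apply: continuous_subspaceT; exact: continuous_gauss_fun.
Qed.

Lemma integral0_gauss0 {R : realType} : @integral0_gauss R 0 = 0.
Proof. by rewrite /integral0_gauss set_itv1 Rintegral_set1. Qed.

(* D and E below vanish at 0, D' = gauss_fun * E and E' changes sign once, from
   positive to negative; so D first increases, then decreases to its limit 0. *)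
Lemma integral0_gauss_sqr_le {R : realType} (x : R) : 0 <= x ->
  integral0_gauss x ^+ 2 <= pi / 4 * (1 - gauss_fun x ^+ 2).
Proof.
rewrite le_eqVlt => /predU1P[<-|x_gt0].
  by rewrite integral0_gauss0 expr0n/= mulr_ge0 ?divr_ge0 ?pi_ge0// subr_ge0
    expr_le1// ?gauss_fun_ge0// gauss_fun_le1.
pose I := @integral0_gauss R; pose g := @gauss_fun R.
pose E := (fun z : R => pi * z * g z - 2 * I z).
pose D := (fun z : R => pi / 4 * (1 - g z ^+ 2) - I z ^+ 2).
have dE (z : R) : 0 < z -> is_derive z 1 E (g z * (pi - 2 - 2 * pi * z ^+ 2)).
  move=> z0; have dg := is_derive_gauss_fun z.
  have dI := is_derive_integral0_gauss z0.
  rewrite /E /I /g; apply: is_derive_eq; rewrite /GRing.scale/=; ring.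
have dD (z : R) : 0 < z -> is_derive z 1 D (g z * E z).
  move=> z0; have dg := is_derive_gauss_fun z.
  have dI := is_derive_integral0_gauss z0.
  rewrite /D /E /I /g; apply: is_derive_eq; by rewrite /GRing.scale/=; field.
have cI (z : R) : 0 <= z -> {within `[0, z], continuous I}.
  exact: within_continuous_integral0_gauss.
have cg (z : R) : {within `[0, z], continuous g}.
  by apply: continuous_subspaceT; exact: continuous_gauss_fun.
have cE (z : R) : 0 <= z -> {within `[0, z], continuous E}.
  move=> z0 u; apply: cvgB; last by apply: cvgMr; exact: cI.
  apply: cvgM; last exact: cg.
  by apply: cvgMr; exact: (continuous_subspaceT (fun=> cvg_id)).
have cD (z : R) : 0 <= z -> {within `[0, z], continuous D}.
  move=> z0 u; apply: cvgB; last by rewrite /= !expr2; apply: cvgM; exact: cI.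
  by apply: cvgMr; apply: cvgB; [exact: cvg_cst|rewrite /= !expr2; apply: cvgM; exact: cg].
have g0 : g 0 = 1 by rewrite /g /gauss_fun expr0n/= oppr0 expR0.
have E0 : E 0 = 0 by rewrite /E /I integral0_gauss0; ring.
have D0 : D 0 = 0 by rewrite /D g0 /I integral0_gauss0; ring.
have g_ge0 (z : R) : 0 <= g z by exact: gauss_fun_ge0.
have sub (u v : R) (h : R -> R) : 0 <= u -> u <= v ->
    {within `[0, v], continuous h} -> {within `[u, v], continuous h}.
  move=> u0 uv; apply: continuous_subspaceW => z /=; rewrite !in_itv/= => /andP[uz ->].
  by rewrite (le_trans u0).
have incr (h h' : R -> R) (u v : R) : 0 <= u -> u <= v ->
    (forall z : R, 0 < z -> is_derive z 1 h (h' z)) ->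
    {within `[0, v], continuous h} ->
    (forall z, u < z < v -> 0 <= h' z) -> h u <= h v.
  move=> u0 uv dh ch h'0; apply: (@ger0_derive1_le_cc R h u v) => //.
  - move=> z; rewrite in_itv/= => /andP[uz _].
    by have [] := dh z (le_lt_trans u0 uz).
  - move=> z; rewrite in_itv/= => /andP[uz zv]; rewrite derive1E.
    have -> := @derive_val _ _ _ _ _ _ _ (dh z (le_lt_trans u0 uz)).
    by apply: h'0; rewrite uz.
  - exact: sub.
  - by rewrite in_itv/= lexx.
  - by rewrite in_itv/= lexx uv.
have decr (h h' : R -> R) (u v : R) : 0 <= u -> u <= v ->
    (forall z : R, 0 < z -> is_derive z 1 h (h' z)) ->
    {within `[0, v], continuous h} ->
    (forall z, u < z < v -> h' z <= 0) -> h v <= h u.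
  move=> u0 uv dh ch h'0; apply: (@ler0_derive1_le_cc R h u v) => //.
  - move=> z; rewrite in_itv/= => /andP[uz _].
    by have [] := dh z (le_lt_trans u0 uz).
  - move=> z; rewrite in_itv/= => /andP[uz zv]; rewrite derive1E.
    have -> := @derive_val _ _ _ _ _ _ _ (dh z (le_lt_trans u0 uz)).
    by apply: h'0; rewrite uz.
  - exact: sub.
  - by rewrite in_itv/= lexx uv.
  - by rewrite in_itv/= lexx.
have pi0 : 0 <= pi :> R by exact: pi_ge0.
have E_incr (v : R) : 0 <= v -> 2 * pi * v ^+ 2 <= pi - 2 -> 0 <= E v.
  move=> v0 vs; rewrite -E0; apply: (incr E _ 0 v (lexx 0) v0 dE (cE _ v0)).
  move=> z /andP[z0 zv]; apply: mulr_ge0 => //; rewrite subr_ge0 (le_trans _ vs)//.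
  by rewrite ler_wpM2l ?mulr_ge0// ler_sqr ?nnegrE// ltW.
have E_decr (u v : R) : 0 <= u -> u <= v -> pi - 2 <= 2 * pi * u ^+ 2 -> E v <= E u.
  move=> u0 uv us; have v0 := le_trans u0 uv.
  apply: (decr E _ u v u0 uv dE (cE _ v0)).
  move=> z /andP[uz zv]; apply: mulr_ge0_le0 => //.
  rewrite subr_le0 (le_trans us)// ler_wpM2l ?mulr_ge0//.
  by rewrite ler_sqr ?nnegrE// ?(le_trans u0)// ltW.
suff : 0 <= D x by rewrite /D subr_ge0.
have x0 := ltW x_gt0.
(* If [E x] is nonnegative then [E] is nonnegative before [x]: it rises from 0 up to the sign change
   of its derivative and then falls to [E x]. So [D] increases from 0 up to [x]. *)
have [Ex|Ex] := leP 0 (E x).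
  rewrite -D0; apply: (incr D _ 0 x (lexx 0) x0 dD (cD _ x0)) => z /andP[z0 zx].
  apply: mulr_ge0 => //.
  have [zs|/ltW zs] := leP (2 * pi * z ^+ 2) (pi - 2).
    by apply: E_incr => //; exact: ltW.
  by apply: (le_trans Ex); apply: E_decr => //; exact: ltW.
(* A negative [E x] places [x] past the sign change, so [E] stays negative and [D] is nonincreasing
   from [x] on; its limit 0 then forces [D x] to be nonnegative. *)
have xs : pi - 2 <= 2 * pi * x ^+ 2.
  rewrite leNgt; apply/negP => /ltW /(E_incr _ x0).
  by rewrite leNgt Ex.
have Dx (y : R) : x <= y -> D y <= D x.
  move=> xy; apply: (decr D _ x y x0 xy dD (cD _ (le_trans x0 xy))).
  move=> z /andP[xz zy]; apply: mulr_ge0_le0 => //.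
  by apply: le_trans (ltW Ex); apply: E_decr => //; exact: ltW.
have limD : D y @[y --> +oo] --> (0 : R).
  rewrite (_ : 0 = pi / 4 * (1 - 0 * 0) - pi / 4 :> R); last by ring.
  apply: cvgB; last exact: cvg_integral0_gauss_sqr.
  apply: cvgMr; apply: cvgB; first exact: cvg_cst.
  by under eq_fun do rewrite expr2; apply: cvgM; exact: cvg_gauss_fun.
rewrite leNgt; apply/negP => Dneg.
have nD : \forall y \near +oo, D x < D y by exact: (cvgr_gt _ limD).
have nx : \forall y \near +oo, x <= y by apply: nbhs_pinfty_ge; exact: num_real.
have [y [/Dx Dy]] := filter_ex (filterI nx nD).
by rewrite ltNge Dy.
Qed.

(** This is the bound 1 on the sine of the sum of two angles with sines [s] and [t]. It follows from
    two instances of [2 x y <= x^2 + y^2], the four squares adding up to 2. *)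
Lemma sqrtr_circle_le1 {R : rcfType} (s t : R) : 0 <= s <= 1 -> 0 <= t <= 1 ->
  Num.sqrt (1 - s ^+ 2) * t + Num.sqrt (1 - t ^+ 2) * s <= 1.
Proof.
move=> /andP[s0 s1] /andP[t0 t1].
have us : 0 <= 1 - s ^+ 2 by rewrite subr_ge0 expr_le1.
have ut : 0 <= 1 - t ^+ 2 by rewrite subr_ge0 expr_le1.
have := sqr_sqrtr us; have := sqr_sqrtr ut.
move: (Num.sqrt (1 - s ^+ 2)) (Num.sqrt (1 - t ^+ 2)) => u v vE uE.
have : 0 <= (u - t) ^+ 2 by exact: sqr_ge0.
have : 0 <= (v - s) ^+ 2 by exact: sqr_ge0.
rewrite !sqrrB uE vE; lra.
Qed.

(** The substitution [x / sqrt 2] turns the weight into [gauss_fun] and yields the factor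
    [sqrt 2]. *)
Lemma integral_expR_section {R : realType} (c d : R) : 0 <= c ->
  (\int[lebesgue_measure]_(x in `[0%R, c]) (expR (- (x ^+ 2 + d ^+ 2) / 2))%:E =
   (Num.sqrt 2 * (expR (- d ^+ 2 / 2) * integral0_gauss (c / Num.sqrt 2)))%:E)%E.
Proof.
move=> c0; set r := Num.sqrt 2 : R.
have r0 : 0 < r by rewrite sqrtr_gt0.
have rr : r * r = 2 by rewrite -expr2 sqr_sqrtr.
have dF (x : R) : is_derive x 1 (fun z : R => z / r) r^-1.
  by apply: is_derive_eq; rewrite /GRing.scale/=; ring.
have F' : derive1 (fun z : R => z / r) = cst r^-1.
  by apply/funext => x; rewrite derive1E; exact: derive_val.
have := @integration_by_substitution_increasing R (fun z => z / r) gauss_fun 0 c c0.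
rewrite F' => H.
have subst : (\int[lebesgue_measure]_(x in `[0%R, (c / r)%R]) (gauss_fun x)%:E =
    \int[lebesgue_measure]_(x in `[0%R, c]) (gauss_fun (x / r) * r^-1)%:E)%E.
  rewrite -[X in `[X, _]](mul0r r^-1) H//.
  - by move=> x y _ _ xy; rewrite ltr_pM2r ?invr_gt0.
  - by move=> x _; exact: cvg_cst.
  - exact: is_cvg_cst.
  - exact: is_cvg_cst.
  - split.
    + by move=> x _; have [] := dF x.
    + by apply: cvg_at_right_filter; apply: cvgMl; exact: cvg_id.
    + by apply: cvg_at_left_filter; apply: cvgMl; exact: cvg_id.
  - by apply: continuous_subspaceT; exact: continuous_gauss_fun.
have Ifin : (\int[lebesgue_measure]_(x in `[0%R, (c / r)%R]) (gauss_fun x)%:E)%E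
    \is a fin_num.
  apply: integrable_fin_num => //.
  apply: continuous_compact_integrable; first exact: segment_compact.
  by apply: continuous_subspaceT; exact: continuous_gauss_fun.
have mg : measurable_fun setT (fun x : R => gauss_fun (x / r) / r).
  apply: measurable_funM => //.
  apply: measurableT_comp; first exact: measurable_gauss_fun.
  exact: measurable_funM.
rewrite /integral0_gauss /Rintegral !EFinM fineK// subst.
rewrite -!ge0_integralZl//.
- apply: eq_integral => x _; rewrite -!EFinM; congr EFin.
  have -> (e g : R) : r * (e * (g * r^-1)) = e * g by field; rewrite gt_eqF.
  rewrite /gauss_fun -expRD; congr expR.
  by rewrite exprMn exprVn -[r ^+ 2]/(r * r) rr; field.
- apply/measurable_EFinP/measurable_funM => //; exact: measurable_funTS.
- move=> x _; rewrite -EFinM lee_fin mulr_ge0 ?expR_ge0//.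
  by rewrite mulr_ge0// ?expR_ge0// invr_ge0 ltW.
- by rewrite lee_fin ltW.
- exact/measurable_EFinP/measurable_funTS.
- by move=> x _; rewrite lee_fin mulr_ge0// ?expR_ge0// invr_ge0 ltW.
Qed.

Lemma integral0_gauss_le_sqrt {R : realType} (c : R) : 0 <= c ->
  integral0_gauss (c / Num.sqrt 2) <=
  Num.sqrt pi / 2 * Num.sqrt (1 - expR (- c ^+ 2 / 2) ^+ 2).
Proof.
move=> c0.
have r0 : 0 < Num.sqrt 2 :> R by rewrite sqrtr_gt0.
have x0 : 0 <= c / Num.sqrt 2 by rewrite divr_ge0// ltW.
have gE : gauss_fun (c / Num.sqrt 2) = expR (- c ^+ 2 / 2).
  by rewrite /gauss_fun exprMn exprVn sqr_sqrtr// mulNr.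
have s1 : 0 <= 1 - expR (- c ^+ 2 / 2) ^+ 2.
  by rewrite subr_ge0 -gE expr_le1// ?gauss_fun_ge0// gauss_fun_le1.
have rhs0 : 0 <= Num.sqrt pi / 2 * Num.sqrt (1 - expR (- c ^+ 2 / 2) ^+ 2).
  by rewrite mulr_ge0 ?sqrtr_ge0// divr_ge0// sqrtr_ge0.
have lhs0 := integral0_gauss_ge0 (c / Num.sqrt 2).
rewrite -ler_sqr ?nnegrE//.
rewrite !exprMn !sqr_sqrtr ?pi_ge0// -gE exprVn.
by have := integral0_gauss_sqr_le x0; rewrite -natrX.
Qed.

(** In each term the outer [sqrt 2] is the arc length factor and the inner one comes from rescaling
    the integral; together they cancel the 2 in [integral0_gauss_le_sqrt]. *)
Lemma gauss_quarter_le {R : realType} (c d : R) : 0 <= c -> 0 <= d ->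
  Num.sqrt 2 * (Num.sqrt 2 * (expR (- d ^+ 2 / 2) * integral0_gauss (c / Num.sqrt 2))) +
  Num.sqrt 2 * (Num.sqrt 2 * (expR (- c ^+ 2 / 2) * integral0_gauss (d / Num.sqrt 2)))
  <= Num.sqrt pi :> R.
Proof.
move=> c0 d0; have e01 (u : R) : 0 <= expR (- u ^+ 2 / 2) <= 1.
  by rewrite expR_ge0 -expR0 ler_expR mulNr oppr_le0 divr_ge0// sqr_ge0.
have := sqrtr_circle_le1 (e01 c) (e01 d).
have := integral0_gauss_le_sqrt c0; have := integral0_gauss_le_sqrt d0.
have /andP[ec _] := e01 c; have /andP[ed _] := e01 d.
rewrite !mulrA -!expr2 sqr_sqrtr//.
move: (expR _) (expR _) ec ed => s t s0 t0.
move: (integral0_gauss _) (integral0_gauss _) => u v hu hv circle.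
have p0 : 0 <= Num.sqrt pi :> R by exact: sqrtr_ge0.
have := ler_wpM2l p0 circle; rewrite mulr1.
have := ler_wpM2l s0 hu; have := ler_wpM2l t0 hv.
move: (Num.sqrt (1 - _)) (Num.sqrt (1 - _)) (Num.sqrt pi) => S T P.
lra.
Qed.

(** * Layer cake estimate for one quarter *)

Definition gauss2 {R : realType} (p : R * R) : R :=
  expR (- (p.1 ^+ 2 + p.2 ^+ 2) / 2).

(** A superlevel set of the weight along the segment at height [d], onto which the left part of a
    quarter is projected. As [gauss2] is symmetric, exchanging [c] and [d] serves the right part. *)
Definition slab {R : realType} (c d t : R) : set R :=
  [set x | 0 <= x <= c /\ t < gauss2 (x, d)].

Lemma measurable_gauss2_section {R : realType} (d : R) :
  measurable_fun setT (fun x : R => gauss2 (x, d)).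
Proof.
rewrite /gauss2 /=; apply: measurableT_comp => //.
apply: measurable_funM => //; apply: measurableT_comp => //.
by apply: measurable_funD => //; exact: exprn_measurable.
Qed.

Lemma measurable_slab {R : realType} (c d t : R) : measurable (slab c d t).
Proof.
rewrite (_ : slab c d t =
    `[0, c] `&` ([set: R] `&` (fun x => gauss2 (x, d)) @^-1` `]t, +oo[)).
  by apply: measurableI => //; exact: measurable_gauss2_section.
by apply/seteqP; split => x /=; rewrite !in_itv/= andbT => -[] // ? [].
Qed.

(** The weight decreases in each coordinate of the first quadrant, so the slab contains all of
    [[0, x]]. It lies in [[0, c]], so [fine] is applied to a finite measure. *)
Lemma slab_length {R : realType} (c d t x y : R) : 0 <= x <= c -> 0 <= d <= y ->
  t < gauss2 (x, y) -> x <= fine (lebesgue_measure (slab c d t)).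
Proof.
move=> /andP[x0 xc] /andP[d0 dy] tx.
have sub : `[0, x] `<=` slab c d t.
  move=> z; rewrite /= in_itv/= => /andP[z0 zx]; split.
    by rewrite z0 (le_trans zx).
  apply: (lt_le_trans tx); rewrite ler_expR ler_pM2r ?invr_gt0// lerN2 lerD//=.
    by rewrite ler_sqr ?nnegrE.
  by rewrite ler_sqr ?nnegrE// (le_trans d0).
have len (u : R) : 0 <= u -> lebesgue_measure `[0, u] = u%:E.
  move=> u0; rewrite lebesgue_measure_itv/= lte_fin; case: ltP => [_|u0'].
    by rewrite -EFinD subr0.
  by congr EFin; apply/eqP; rewrite eq_le u0.
have up : (lebesgue_measure (slab c d t) <= c%:E)%E.
  rewrite -len ?(le_trans x0)//; apply: le_measure; rewrite ?inE//.
    exact: measurable_slab.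
  by move=> z [] /=; rewrite in_itv.
have low : (x%:E <= lebesgue_measure (slab c d t))%E.
  rewrite -len//; apply: le_measure; rewrite ?inE//; exact: measurable_slab.
rewrite -lee_fin fineK//; apply/fin_numP; split; apply/eqP => E.
  by move: low; rewrite E.
by move: up; rewrite E.
Qed.

Lemma sqrtr_sqrD_le {R : rcfType} (u v : R) : `|u| <= `|v| ->
  Num.sqrt (v ^+ 2 + u ^+ 2) <= Num.sqrt 2 * `|v|.
Proof.
move=> uv; rewrite -sqrtr_sqr -sqrtrM// ler_wsqrtr// mulr_natl mulr2n lerD2l.
by rewrite -(real_normK (num_real u)) -(real_normK (num_real v)) ler_sqr ?nnegrE.
Qed.

(** The arc is cut at [m]. The left part is controlled by its first coordinate and the right part by
    its second, both with constant [sqrt 2]; [slab_length] bounds the range of that coordinate at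
    level [t]. *)
Lemma finely_coverable_arc {R : realType} (b : R) (f : R -> R) (m : R * R) (t : R) :
  concave_on 0 b f -> descending_arc b f m ->
  (forall p, descending_arc b f p -> p.1 + p.2 <= m.1 + m.2) ->
  finely_coverable (descending_arc b f `&` [set p | t < gauss2 p])
    (Num.sqrt 2 * fine (lebesgue_measure (slab m.1 m.2 t)) +
     Num.sqrt 2 * fine (lebesgue_measure (slab m.2 m.1 t))).
Proof.
move=> cf Am mmax.
have [cover lip1 lip2] := descending_arc_split cf Am mmax.
have [/andP[m10 _] /andP[m20 _] _] := Am.
apply: (@finely_coverableS _ _ (
  (descending_arc b f `&` [set p | p.1 <= m.1 /\ m.2 <= p.2] `&` [set p | t < gauss2 p]) `|`
  (descending_arc b f `&` [set p | m.1 <= p.1 /\ p.2 <= m.2] `&` [set p | t < gauss2 p]))).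
  by move=> p [Ap tp]; case: (cover _ Ap) => ?; [left|right].
apply: finely_coverableU.
- apply: (@finely_coverable_lipschitz _ _ fst) => //; first exact: fine_ge0.
  + move=> p [[[/andP[p0 _] _ _] [pm mp]] tp]; rewrite p0/=.
    apply: (@slab_length _ _ _ _ _ p.2); rewrite ?p0 ?m20//.
  + move=> p q [[Ap [pm mp]] _] [[Aq [qm mq]] _]; apply: sqrtr_sqrD_le.
    exact: lip1.
- apply: (@finely_coverable_lipschitz _ _ snd) => //; first exact: fine_ge0.
  + move=> p [[[/andP[p0 _] /andP[p20 _] _] [pm mp]] tp]; rewrite p20/=.
    apply: (@slab_length _ _ _ _ _ p.1); rewrite ?p20 ?m10//.
    by move: tp; rewrite /gauss2 /= addrC.
  + move=> p q [[Ap [pm mp]] _] [[Aq [qm mq]] _]; rewrite /edist2 [X in Num.sqrt X]addrC.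
    by apply: sqrtr_sqrD_le; exact: lip2.
Qed.

Lemma finely_coverable_isometry {R : realType} (h : R * R -> R * R)
    (A : set (R * R)) (L : R) :
  (forall p q, edist2 (h p) (h q) = edist2 p q) ->
  finely_coverable A L -> finely_coverable (h @^-1` A) L.
Proof.
move=> hi cA delta /cA[N [E [d [AE Ed dle dL]]]].
exists N, (fun i => h @^-1` E i), d; split => //.
  by move=> p /AE[i iN Ep]; exists i.
move=> i; apply: le_trans (Ed i); apply: ge_ereal_sup => _ [->|[p Ep [q Eq <-]]].
  exact: diam2_ge0.
by apply: ereal_sup_ubound; right; exists (h p) => //; exists (h q); rewrite ?hi.
Qed.

(* Unlike [ge0_le_integral], no measurability: the integral of a nonnegative
   function is a supremum over simple functions below it. *)
Lemma le_integral_nonmeasurable d (T : measurableType d) (R : realType)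
    (mu : {measure set T -> \bar R}) (D : set T) (f1 f2 : T -> \bar R) :
  (forall x, D x -> (0 <= f1 x)%E) -> (forall x, D x -> (f1 x <= f2 x)%E) ->
  (\int[mu]_(x in D) f1 x <= \int[mu]_(x in D) f2 x)%E.
Proof.
move=> f10 f12; rewrite !ge0_integralE//; last first.
  by move=> x Dx; exact: le_trans (f10 _ Dx) (f12 _ Dx).
apply: le_ereal_sup => _ [h hf <-]; exists h => // x.
by apply: (le_trans (hf x)); exact: lee_restrict.
Qed.

Lemma hausdorff1_ge0 {R : realType} (A : set (R * R)) : (0 <= hausdorff1 A)%E.
Proof.
apply: (@le_trans _ _ (hausdorff1_delta 1 A)).
  apply: le_ereal_inf_tmp => _ [E _ <-].
  by apply: nneseries_ge0 => *; exact: diam2_ge0.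
by apply: ereal_sup_ubound; exists 1 => //=.
Qed.

Lemma measurable_nonneg {R : realType} : measurable [set t : R | 0 <= t].
Proof.
rewrite (_ : [set t : R | 0 <= t] = [set` `[0, +oo[])//.
by apply/seteqP; split => t /=; rewrite in_itv/= andbT.
Qed.

(** Tonelli's theorem for the region [A] under the graph of the weight over [[0, c]]: its sections
    at fixed [t] are slabs, those at fixed [x] are the intervals from 0 to [gauss2 (x, d)]. *)
Lemma layer_cake {R : realType} (c d : R) :
  measurable_fun [set t : R | 0 <= t]
    (fun t => lebesgue_measure (slab c d t)) /\
  (\int[lebesgue_measure]_(t in [set t : R | (0 <= t)%R])
      lebesgue_measure (slab c d t) =
   \int[lebesgue_measure]_(x in `[0%R, c]) (gauss2 (x, d))%:E)%E.
Proof.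
pose A := [set p : R * R | [/\ 0 <= p.1, 0 <= p.2 <= c & p.1 < gauss2 (p.2, d)]].
have mA : measurable A.
  rewrite (_ : A = (`[0, +oo[ `*` `[0, c]) `&`
      ([set: R * R] `&` (fun p => gauss2 (p.2, d) - p.1) @^-1` `]0, +oo[)).
    apply: measurableI; first exact: measurableX.
    apply: measurable_funB => //.
    exact: (measurableT_comp (measurable_gauss2_section d) measurable_snd).
  apply/seteqP; split => p /=; rewrite !in_itv/= !andbT subr_gt0.
    by case.
  by move=> [[? ?] [_ ?]].
have secA t : 0 <= t -> xsection A t = slab c d t.
  move=> t0; apply/seteqP; split => x; rewrite /xsection /= inE /A/=.
    by case.
  by case.
have mF : measurable_fun [set: R] (lebesgue_measure \o xsection A).
  exact: measurable_fun_xsection.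
have mge0 := @measurable_nonneg R.
split.
  apply: (eq_measurable_fun (fun t => lebesgue_measure (xsection A t))).
    by move=> t; rewrite inE /= => t0; rewrite secA.
  exact: measurable_funTS.
have mind : measurable_fun setT (fun p : R * R => (\1_A p)%:E : \bar R).
  exact/measurable_EFinP/measurable_indic.
have sect t : 0 <= t ->
    (\int[lebesgue_measure]_x (\1_A (t, x))%:E = lebesgue_measure (slab c d t))%E.
  move=> t0; transitivity (\int[lebesgue_measure]_x (\1_(slab c d t) x)%:E)%E.
    apply: eq_integral => x _; congr EFin; rewrite !indicE; congr ((nat_of_bool _)%:R).
    by apply/idP/idP; rewrite !inE /A/=; [case|case].
  by rewrite integral_indic ?setIT//; exact: measurable_slab.
have secx x : x \in `[0, c] ->
    (\int[lebesgue_measure]_t (\1_A (t, x))%:E = (gauss2 (x, d))%:E)%E.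
  rewrite in_itv/= => xc.
  transitivity (\int[lebesgue_measure]_t
      (\1_([set` `[0, gauss2 (x, d)[] : set R) t)%:E)%E.
    apply: eq_integral => t _; congr EFin; rewrite !indicE; congr ((nat_of_bool _)%:R).
    apply/idP/idP; rewrite !inE /A/= in_itv/=; first by case => -> _ ->.
    by case/andP.
  rewrite integral_indic ?setIT//; apply: (eq_trans (lebesgue_measure_itv _)).
  by rewrite /= lte_fin expR_gt0 -EFinD subr0.
rewrite integral_mkcond [RHS]integral_mkcond.
transitivity (\int[lebesgue_measure]_t \int[lebesgue_measure]_x
    (\1_A (t : R, x : R))%:E)%E.
  apply: eq_integral => t _; rewrite patchE.
  case: ifPn => [|/negP]; rewrite inE /= => t0; first by rewrite sect.
  rewrite integral0_eq// => x _; rewrite indicE memNset//.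
  by case => /= t0' _ _; apply: t0.
have /= -> := fubini_tonelli (m1 := lebesgue_measure) (m2 := lebesgue_measure)
  (fun p : R * R => (\1_A p)%:E) mind _; last by move=> p; rewrite lee_fin.
apply: eq_integral => x _; rewrite patchE.
case: ifPn => [|/negP]; rewrite inE /= => xc; first by rewrite secx.
rewrite integral0_eq// => t _; rewrite indicE memNset//.
by case => /= _ xc' _; apply: xc; rewrite in_itv.
Qed.

Lemma integral_slabs_le {R : realType} (c d : R) : 0 <= c -> 0 <= d ->
  let Q t := Num.sqrt 2 * fine (lebesgue_measure (slab c d t)) +
             Num.sqrt 2 * fine (lebesgue_measure (slab d c t)) in
  measurable_fun [set t : R | 0 <= t] (fun t => (Q t)%:E) /\
  (\int[lebesgue_measure]_(t in [set t : R | (0 <= t)%R]) (Q t)%:E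
     <= (Num.sqrt pi)%:E)%E.
Proof.
move=> c0 d0 /=.
have mge0 := @measurable_nonneg R.
have fin (u v t : R) : 0 <= u ->
    ((fine (lebesgue_measure (slab u v t)))%:E = lebesgue_measure (slab u v t))%E.
  move=> u0; rewrite fineK// ge0_fin_numE//.
  apply: (@le_lt_trans _ _ (lebesgue_measure (`[0%R, u] : set R))).
    apply: le_measure; rewrite ?inE//; first exact: measurable_slab.
    by move=> z [] /=; rewrite in_itv.
  by rewrite lebesgue_measure_itv/=; case: ifP => // _; rewrite -EFinD ltry.
have QE : (fun t => (Num.sqrt 2 * fine (lebesgue_measure (slab c d t)) +
             Num.sqrt 2 * fine (lebesgue_measure (slab d c t)))%:E) =
  (fun t => ((Num.sqrt 2)%:E * lebesgue_measure (slab c d t) +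
             (Num.sqrt 2)%:E * lebesgue_measure (slab d c t)))%E.
  by apply/funext => t; rewrite EFinD !EFinM !fin.
have [m1 i1] := layer_cake c d; have [m2 i2] := layer_cake d c.
have mm (u v : R) : measurable_fun [set t : R | 0 <= t]
      (fun t => lebesgue_measure (slab u v t)) ->
    measurable_fun [set t : R | 0 <= t]
      (fun t => (Num.sqrt 2)%:E * lebesgue_measure (slab u v t))%E.
  exact: measurable_funeM.
rewrite QE; split; first by apply: emeasurable_funD; exact: mm.
rewrite ge0_integralD//; [|by move=> *; exact: mule_ge0|exact: mm|
  by move=> *; exact: mule_ge0|exact: mm].
rewrite !ge0_integralZl// i1 i2 !integral_expR_section// -!EFinM -EFinD lee_fin.
exact: gauss_quarter_le.
Qed.

(** * Reflections and assembly of the four quarters *)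

Lemma concave_on_opp {R : realType} (a b : R) (f : R -> R) :
  concave_on a b f -> concave_on (- b) (- a) (fun x => f (- x)).
Proof.
move=> cf x y t xab yab t01; rewrite opprD -!mulrN; apply: cf => //.
  by case/andP: xab => ? ?; rewrite lerNr lerNl; apply/andP.
by case/andP: yab => ? ?; rewrite lerNr lerNl; apply/andP.
Qed.

(** Here [h] is the reflection bringing a quarter of the boundary into the first quadrant. The
    function [Q] is a measurable majorant of the lengths of the superlevel sets, and hiding it
    behind an existential hides the split point too. *)
Lemma quarter_bound {R : realType} (a b : R) (f : R -> R) (h : R * R -> R * R) :
  a <= 0 -> 0 <= b -> concave_on a b f ->
  (forall x, a <= x <= b -> 0 <= f x) ->
  (forall x, a <= x <= b -> f x <= f 0) ->
  (forall p q, edist2 (h p) (h q) = edist2 p q) ->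
  (forall p, gauss2 (h p) = gauss2 p) ->
  exists Q : R -> R,
    [/\ forall t, finely_coverable
          (h @^-1` descending_arc b f `&` [set p | t < gauss2 p]) (Q t),
        forall t, 0 <= Q t,
        measurable_fun [set t : R | 0 <= t] (fun t => (Q t)%:E) &
        (\int[lebesgue_measure]_(t in [set t : R | (0 <= t)%R]) (Q t)%:E
         <= (Num.sqrt pi)%:E)%E].
Proof.
move=> a0 b0 cf f0 fmax hd hg.
have ab x : 0 <= x <= b -> a <= x <= b.
  by case/andP => x0 ->; rewrite (le_trans a0).
have cf0 : concave_on 0 b f by move=> x y t xb yb; apply: cf; exact: ab.
have [m Am mmax] : exists2 m, descending_arc b f m &
    forall p, descending_arc b f p -> p.1 + p.2 <= m.1 + m.2.
  apply: descending_arc_argmax => // x xb.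
  by rewrite f0 ?fmax// ab.
have [/andP[m10 _] /andP[m20 _] _] := Am.
have [mQ iQ] := integral_slabs_le m10 m20.
eexists; split; [| |exact: mQ|exact: iQ].
- move=> t /=; have := finely_coverable_arc t cf0 Am mmax.
  move=> /(finely_coverable_isometry hd); apply: finely_coverableS => p [Ap tp].
  by split => //=; rewrite hg.
- by move=> t; rewrite addr_ge0// mulr_ge0// fine_ge0.
Qed.

(** The left half plane is reduced to the right one by reflection in the vertical axis, which
    exchanges the roles of the endpoints [a] and [b]. *)
Lemma boundary2_cover {R : realType} (a b : R) (f g : R -> R) (p : R * R) :
  a < 0 -> 0 < b -> concave_on a b f -> concave_on a b g ->
  (forall x, a <= x <= b -> 0 <= f x) ->
  (forall x, a <= x <= b -> 0 <= g x) ->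
  f a = 0 -> f b = 0 -> g a = 0 -> g b = 0 ->
  (forall x, a <= x <= b -> f x <= f 0) ->
  (forall x, a <= x <= b -> g x <= g 0) ->
  boundary2 [set p : R * R | (a <= p.1 <= b)%R /\ (- g p.1 <= p.2 <= f p.1)%R] p ->
  (descending_arc b f p \/ descending_arc b g (p.1, - p.2)) \/
  (descending_arc (- a) (fun x => f (- x)) (- p.1, p.2) \/
   descending_arc (- a) (fun x => g (- x)) (- p.1, - p.2)).
Proof.
move=> a0 b0 cf cg f0 g0 fa fb ga gb fmax gmax bp.
have [p0|/ltW p0] := leP 0 p.1; [left|right].
  exact: (boundary2_right a0 cf cg f0 g0 fa ga fmax gmax bp p0).
pose h (q : R * R) := (- q.1, q.2).
have ch : continuous h.
  by apply: continuous_pair; [exact: continuousN_plane continuous_fst_plane|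
                              exact: continuous_snd_plane].
have hh : involutive h by move=> q; rewrite /h /= opprK -surjective_pairing.
have := boundary2_involution ch hh bp.
have opp x : - b <= x <= - a -> a <= - x <= b.
  by case/andP => ? ?; rewrite lerNr lerNl; apply/andP.
rewrite (_ : h @^-1` _ = [set p : R * R | (- b <= p.1 <= - a)%R /\
    (- g (- p.1) <= p.2 <= f (- p.1))%R]); last first.
  apply/seteqP; split => q /= [/andP[q1 q2] q3]; split => //.
    by rewrite lerNl lerNr q1 q2.
  by apply: opp; rewrite q1 q2.
move=> bq; apply: (boundary2_right (a := - b) (b := - a) _ _ _ _ _ _ _ _ _ bq).
- by rewrite oppr_lt0.
- exact: concave_on_opp.
- exact: concave_on_opp.
- by move=> x /opp; exact: f0.
- by move=> x /opp; exact: g0.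
- by rewrite opprK.
- by rewrite opprK.
- by move=> x /opp; rewrite oppr0; exact: fmax.
- by move=> x /opp; rewrite oppr0; exact: gmax.
- by rewrite /= oppr_ge0.
Qed.

Theorem theorem1p3 (R : realType) (a b : R) (f g : R -> R) :
  a < 0 -> 0 < b ->
  concave_on a b f -> concave_on a b g ->
  (forall x, a <= x <= b -> 0 <= f x) ->
  (forall x, a <= x <= b -> 0 <= g x) ->
  f a = 0 -> f b = 0 -> g a = 0 -> g b = 0 ->
  (forall x, a <= x <= b -> f x <= f 0) ->
  (forall x, a <= x <= b -> g x <= g 0) ->
  (gauss_perimeter2
     [set p : R * R | (a <= p.1 <= b)%R /\ (- g p.1 <= p.2 <= f p.1)%R]
   <= (2 / Num.sqrt pi)%:E)%E.
Proof.
move=> a0 b0 cf cg f0 g0 fa fb ga gb fmax gmax.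
have [a0' b0'] : - b <= 0 /\ 0 <= - a by rewrite oppr_le0 oppr_ge0 !ltW.
have opp x : - b <= x <= - a -> a <= - x <= b.
  by case/andP => ? ?; rewrite lerNr lerNl; apply/andP.
have sqrBN (u v : R) : (- u - - v) ^+ 2 = (u - v) ^+ 2 by rewrite -opprD sqrrN.
(* The identity, the reflections in the two axes and the one in the origin preserve both [edist2]
   and [gauss2]; each serves one quarter. *)
have quarter_right k h := @quarter_bound R a b k h (ltW a0) (ltW b0).
have quarter_left k h := @quarter_bound R (- b) (- a) k h a0' b0'.
have [Q1 [c1 p1 m1 i1]] : exists Q, _ := quarter_right f id cf f0 fmax
  (fun _ _ => erefl) (fun _ => erefl).
have [Q2 [c2 p2 m2 i2]] := quarter_right g (fun p => (p.1, - p.2)) cg g0 gmax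
  ltac:(by move=> p q; rewrite /edist2 /= sqrBN)
  ltac:(by move=> p; rewrite /gauss2 /= sqrrN).
have [Q3 [c3 p3 m3 i3]] := quarter_left (fun x => f (- x)) (fun p => (- p.1, p.2))
  (concave_on_opp cf) (fun x xab => f0 _ (opp _ xab))
  ltac:(by move=> x /opp; rewrite oppr0; exact: fmax)
  ltac:(by move=> p q; rewrite /edist2 /= sqrBN)
  ltac:(by move=> p; rewrite /gauss2 /= sqrrN).
have [Q4 [c4 p4 m4 i4]] := quarter_left (fun x => g (- x)) (fun p => (- p.1, - p.2))
  (concave_on_opp cg) (fun x xab => g0 _ (opp _ xab))
  ltac:(by move=> x /opp; rewrite oppr0; exact: gmax)
  ltac:(by move=> p q; rewrite /edist2 /= !sqrBN)
  ltac:(by move=> p; rewrite /gauss2 /= !sqrrN).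
have pi0 : 0 < pi :> R by exact: pi_gt0.
have s0 : 0 < Num.sqrt pi :> R by rewrite sqrtr_gt0.
rewrite /gauss_perimeter2.
(* Four quarters at [sqrt pi] each give [4 * sqrt pi / (2 * pi)], which is [2 / sqrt pi]. *)
apply: (@le_trans _ _ (((2 * pi)^-1)%:E *
    ((Num.sqrt pi)%:E + (Num.sqrt pi)%:E + ((Num.sqrt pi)%:E + (Num.sqrt pi)%:E)))%E);
  last first.
  rewrite -!EFinD -EFinM lee_fin -{1}(sqr_sqrtr (ltW pi0)).
  move: (Num.sqrt pi) s0 => s s0; rewrite le_eqVlt; apply/orP; left; apply/eqP.
  by field; rewrite gt_eqF.
apply: lee_wpmul2l; first by rewrite lee_fin invr_ge0 mulr_ge0// ltW.
(* At each level [t] the four arcs cover the part of the boundary where the weight exceeds [t], so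
   its length is at most the sum of the four majorants. *)
apply: (@le_trans _ _ (\int[lebesgue_measure]_(t in [set t : R | (0 <= t)%R])
  ((Q1 t)%:E + (Q2 t)%:E + ((Q3 t)%:E + (Q4 t)%:E)))%E).
  apply: le_integral_nonmeasurable => t _; first exact: hausdorff1_ge0.
  rewrite -!EFinD; apply: hausdorff1_finely_coverable.
  have := finely_coverableU (finely_coverableU (c1 t) (c2 t))
                            (finely_coverableU (c3 t) (c4 t)).
  apply: finely_coverableS => p [bp tp].
  have [[A|A]|[A|A]] := boundary2_cover a0 b0 cf cg f0 g0 fa fb ga gb fmax gmax bp.
  - by left; left; split.
  - by left; right; split.
  - by right; left; split.
  - by right; right; split.
have nn := @measurable_nonneg R.
have q1 t : (0 <= (Q1 t)%:E)%E by rewrite lee_fin.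
have q2 t : (0 <= (Q2 t)%:E)%E by rewrite lee_fin.
have q3 t : (0 <= (Q3 t)%:E)%E by rewrite lee_fin.
have q4 t : (0 <= (Q4 t)%:E)%E by rewrite lee_fin.
rewrite ge0_integralD//; first last.
- exact: emeasurable_funD.
- by move=> t _; rewrite adde_ge0.
- exact: emeasurable_funD.
- by move=> t _; rewrite adde_ge0.
rewrite !ge0_integralD//.
by apply: leeD; apply: leeD.
Qed.
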